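(* For all addressing machines $M,N\in\mathcal{M}$: $M\equiv_{\mathbb{A}}N$ if and only if there exists $Z\in\mathcal{M}$ with $M\twoheadrightarrow_c Z$ and $N\twoheadrightarrow_c Z$.
   Context: Addressing machines. Fix a countable set $\mathbb{A}$ of addresses and a symbol $\varnothing\notin\mathbb{A}$; put $\mathbb{A}_\varnothing=\mathbb{A}\cup\{\varnothing\}$. A tape is a finite list $[a_1,\dots,a_n]$ of elements of $\mathbb{A}$; $a::T$ is the tape with head $a$ and tail $T$, and $T@T'$ is concatenation. A program is a finite list of instructions generated by the grammar $P::=\mathtt{Load}\ i;P\mid A$, $A::=\mathtt{App}(i,j,k);A\mid C$, $C::=\mathtt{Call}\ i\mid\varepsilon$ with $i,j,k\in\mathbb{N}$. For $r\in\mathbb{N}$ and $I\subseteq\{0,\dots,r-1\}$, $I\models^r P$ is the least relation such that: $I\models^r\varepsilon$; $I\models^r\mathtt{Call}\ i$ if $i\in I$; $I\models^r\mathtt{App}(i,j,k);A$ if $i,j\in I$ and either ($k<r$ and $I\cup\{k\}\models^r A$) or ($k\ge r$ and $I\models^r A$); $I\models^r\mathtt{Load}\ i;P$ if either ($i<r$ and $I\cup\{i\}\models^r P$) or ($i\ge r$ and $I\models^r P$). An addressing machine is $M=\langle R_0,\dots,R_{r-1},P,T\rangle$ with registers $R_i\in\mathbb{A}_\varnothing$, a program $P$ valid w.r.t. the registers (i.e. $\{i<r\mid R_i\ne\varnothing\}\models^r P$) and a tape $T$; $\mathcal{M}$ is the set of all addressing machines, with components $M.r,M.\vec R,M.R_i,M.P,M.T$.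 $\vec R[R_i:=a]$ is $\vec R$ with $R_i$ replaced by $a$ if $i<r$, unchanged if $i\ge r$. Fix a bijection $\#:\mathcal{M}\to\mathbb{A}$ with inverse $\#^{-1}$. $M@T'=\langle M.\vec R,M.P,M.T@T'\rangle$; $a\cdot b=\#(\#^{-1}(a)@[b])$. Head reduction $\to_h$: $\langle\vec R,\mathtt{Load}\ i;P,a::T\rangle\to_h\langle\vec R[R_i:=a],P,T\rangle$, $\langle\vec R,\mathtt{App}(i,j,k);P,T\rangle\to_h\langle\vec R[R_k:=R_i\cdot R_j],P,T\rangle$, $\langle\vec R,\mathtt{Call}\ i,T\rangle\to_h\#^{-1}(R_i)@T$; $\twoheadrightarrow_h$ its reflexive-transitive closure. Induced relations: for a relation $\equiv_R$ on $\mathcal{M}$, $a\simeq_R b$ iff $\#^{-1}(a)\equiv_R\#^{-1}(b)$; on $\mathbb{A}_\varnothing$, both $\varnothing$ or both addresses related; componentwise on tuples/tapes of equal length; $M=_R N$ iff $M.\vec R\simeq_R N.\vec R$, $M.P=N.P$, $M.T\simeq_R N.T$. $\equiv_{\mathbb{A}}$ is the least equivalence relation on $\mathcal{M}$ such that $M\twoheadrightarrow_h Z$ and $Z=_{\mathbb{A}}N$ imply $M\equiv_{\mathbb{A}}N$ ($=_{\mathbb{A}}$ induced by $\equiv_{\mathbb{A}}$). The reduction $\to_c$ is the least relation on $\mathcal{M}$ containing $\to_h$ and closed under: if $0\le i<r$, $R_i=a\in\mathbb{A}$ and $\#^{-1}(a)\to_c M'$, then $\langle\vec R,P,T\rangle\to_c\langle\vec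 R[R_i:=\#M'],P,T\rangle$; if $T=[a_0,\dots,a_n]$, $0\le i\le n$ and $\#^{-1}(a_i)\to_c M'$, then $\langle\vec R,P,T\rangle\to_c\langle\vec R,P,[a_0,\dots,a_{i-1},\#M',a_{i+1},\dots,a_n]\rangle$. $\twoheadrightarrow_c$ is its reflexive-transitive closure. *)

(* Defs.v *)
From mathcomp Require Export all_boot.
From Stdlib Require List.
From Stdlib Require Export Relation_Operators.

Set Implicit Arguments.
Unset Strict Implicit.
Unset Printing Implicit Defensive.

(* The three syntactic categories C, A, P of the grammar of programs. *)
Inductive cprog : Type :=
  | EpsI
  | CallI (i : nat).

Inductive aprog : Type :=
  | AppI (i j k : nat) (A : aprog)
  | AEnd (C : cprog).

Inductive program : Type :=
  | LoadI (i : nat) (P : program)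
  | PEnd (A : aprog).

Coercion AEnd : cprog >-> aprog.
Coercion PEnd : aprog >-> program.

Section Validity.
Context (r : nat).

Inductive cvalid (I : {set 'I_r}) : cprog -> Prop :=
  | cvalid_eps : cvalid I EpsI
  | cvalid_call (i : 'I_r) : i \in I -> cvalid I (CallI i).

Inductive avalid (I : {set 'I_r}) : aprog -> Prop :=
  | avalid_app_in (i j k : 'I_r) A :
      i \in I -> j \in I -> avalid (k |: I) A -> avalid I (AppI i j k A)
  | avalid_app_out (i j : 'I_r) (k : nat) A :
      i \in I -> j \in I -> r <= k -> avalid I A -> avalid I (AppI i j k A)
  | avalid_end C : cvalid I C -> avalid I (AEnd C).

Inductive valid (I : {set 'I_r}) : program -> Prop :=
  | valid_load_in (i : 'I_r) P : valid (i |: I) P -> valid I (LoadI i P)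
  | valid_load_out (i : nat) P : r <= i -> valid I P -> valid I (LoadI i P)
  | valid_end A : avalid I A -> valid I (PEnd A).

(* Boolean counterpart of [valid], used in the type of machines so that the
   equality of two machines does not depend on their validity proofs. *)
Definition has_reg (I : {set 'I_r}) (i : nat) : bool :=
  if insub i is Some x then x \in I else false.

Definition add_reg (I : {set 'I_r}) (i : nat) : {set 'I_r} :=
  if insub i is Some x then x |: I else I.

Definition cvalidb (I : {set 'I_r}) (C : cprog) : bool :=
  if C is CallI i then has_reg I i else true.

Fixpoint avalidb (I : {set 'I_r}) (A : aprog) : bool :=
  match A with
  | AppI i j k A' => [&& has_reg I i, has_reg I j & avalidb (add_reg I k) A']
  | AEnd C => cvalidb I C
  end.

Fixpoint validb (I : {set 'I_r}) (P : program) : bool :=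
  match P with
  | LoadI i P' => validb (add_reg I i) P'
  | PEnd A => avalidb I A
  end.

Lemma has_regP (I : {set 'I_r}) i :
  reflect (exists2 x : 'I_r, x \in I & val x = i) (has_reg I i).
Proof.
rewrite /has_reg; case: insubP => [x _ <-|].
  by apply: (iffP idP) => [xI|[y yI /val_inj <- //]]; exists x.
by move=> ni; constructor=> -[x _ xi]; rewrite -xi ltn_ord in ni.
Qed.

Lemma add_reg_ord (I : {set 'I_r}) (x : 'I_r) : add_reg I x = x |: I.
Proof. by rewrite /add_reg valK. Qed.

Lemma add_reg_out (I : {set 'I_r}) i : r <= i -> add_reg I i = I.
Proof. by move=> ri; rewrite /add_reg insubF // ltnNge ri. Qed.

Lemma cvalidP I C : reflect (cvalid I C) (cvalidb I C).
Proof.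
case: C => [|i] /=; first by do 2!constructor.
apply: (iffP (has_regP I i)) => [[x xI <-]|H]; first exact: cvalid_call.
by inversion H; eexists; eauto.
Qed.

Lemma avalidP I A : reflect (avalid I A) (avalidb I A).
Proof.
elim: A I => [i j k A IH|C] I /=; last first.
  apply: (iffP (cvalidP I C)) => [|H]; first exact: avalid_end.
  by inversion H.
apply: (iffP and3P) => [[/has_regP[x xI <-] /has_regP[y yI <-] /IH]|H].
  case: (ltnP k r) => kr; last by rewrite add_reg_out //; apply: avalid_app_out.
  by rewrite (add_reg_ord I (Ordinal kr)) => /avalid_app_in; apply.
inversion H as [i' j' k' A' iI jI vA | i' j' k' A' iI jI rk vA |]; subst.
  split; [by apply/has_regP; exists i'|by apply/has_regP; exists j'|].
  by apply/IH; rewrite add_reg_ord.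
split; [by apply/has_regP; exists i'|by apply/has_regP; exists j'|].
by apply/IH; rewrite add_reg_out.
Qed.

Lemma validP I P : reflect (valid I P) (validb I P).
Proof.
elim: P I => [i P IH|A] I /=; last first.
  apply: (iffP (avalidP I A)) => [|H]; first exact: valid_end.
  by inversion H.
apply: (iffP (IH _)) => [|H].
  case: (ltnP i r) => ir; last by rewrite add_reg_out //; apply: valid_load_out.
  by rewrite (add_reg_ord I (Ordinal ir)) => /valid_load_in.
by inversion H; rewrite ?add_reg_ord ?add_reg_out.
Qed.

End Validity.

Definition registers (A : Type) := seq (option A).

Definition initialized (A : Type) (R : registers A) (r : nat) : {set 'I_r} :=
  [set i : 'I_r | isSome (nth None R i)].

Definition upd (A : Type) (R : registers A) (i : nat) (a : A) : registers A :=
  if i < size R then set_nth None R i (Some a) else R.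

Definition valid_for (A : Type) (R : registers A) (P : program) : bool :=
  validb (initialized R (size R)) P.

Record machine (A : Type) : Type := Machine {
  regs : registers A;
  prog : program;
  tape : seq A;
  machine_valid : valid_for regs prog
}.

Lemma size_upd (A : Type) (R : registers A) i a : size (upd R i a) = size R.
Proof. by rewrite /upd; case: ifP => // lt_i; rewrite size_set_nth; apply/maxn_idPr. Qed.

Lemma initialized_upd (A : Type) (R : registers A) i a :
  initialized (upd R i a) (size R) = add_reg (initialized R (size R)) i.
Proof.
rewrite /upd; case: ltnP => [lt_i|/add_reg_out -> //].
apply/setP=> j; rewrite (add_reg_ord _ (Ordinal lt_i)) !inE nth_set_nth /= -val_eqE /=.
by case: eqP.
Qed.

(* Executing an instruction, or replacing the content of an initialized
   register, preserves validity: the targets of the rules below exist. *)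
Lemma valid_for_load (A : Type) (R : registers A) i (P : program) a :
  valid_for R (LoadI i P) -> valid_for (upd R i a) P.
Proof. by rewrite /valid_for size_upd initialized_upd. Qed.

Lemma valid_for_app (A : Type) (R : registers A) i j k (Q : aprog) a :
  valid_for R (AppI i j k Q) -> valid_for (upd R k a) Q.
Proof. by rewrite /valid_for size_upd initialized_upd /= => /and3P[]. Qed.

Lemma valid_for_upd (A : Type) (R : registers A) i (P : program) a b :
  nth None R i = Some a -> valid_for R P -> valid_for (upd R i b) P.
Proof.
move=> Ri; rewrite /valid_for size_upd initialized_upd /add_reg.
case: insubP => // x _ xi; suff -> : x |: initialized R (size R) = initialized R (size R) by [].
apply/setP=> j; rewrite !inE; case: eqP => // ->.
by move: xi => /= ->; rewrite Ri.
Qed.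

Definition append (A : Type) (M : machine A) (T : seq A) : machine A :=
  @Machine A (regs M) (prog M) (tape M ++ T) (machine_valid M).

(* In what follows [num] is the bijection # from machines to addresses and
   [lookup] is its inverse. *)

Definition addr_app (A : Type) (num : machine A -> A) (lookup : A -> machine A)
    (a b : A) : A :=
  num (append (lookup a) [:: b]).

Inductive head_step (A : Type) (num : machine A -> A) (lookup : A -> machine A) :
    machine A -> machine A -> Prop :=
  | head_load R i (P : program) a T
      (v : valid_for R (LoadI i P)) (v' : valid_for (upd R i a) P) :
      head_step num lookup (Machine (a :: T) v) (Machine T v')
  | head_app R i j k (Q : aprog) a b T
      (v : valid_for R (AppI i j k Q))
      (v' : valid_for (upd R k (addr_app num lookup a b)) Q) :
      nth None R i = Some a -> nth None R j = Some b ->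
      head_step num lookup (Machine T v) (Machine T v')
  | head_call R i a T (v : valid_for R (CallI i)) :
      nth None R i = Some a ->
      head_step num lookup (Machine T v) (append (lookup a) T).

Definition head_steps (A : Type) (num : machine A -> A) (lookup : A -> machine A) :
    machine A -> machine A -> Prop :=
  clos_refl_trans (machine A) (head_step num lookup).

Definition addr_rel (A : Type) (lookup : A -> machine A)
    (E : machine A -> machine A -> Prop) (a b : A) : Prop :=
  E (lookup a) (lookup b).

Inductive opt_rel (A : Type) (E : A -> A -> Prop) : option A -> option A -> Prop :=
  | opt_rel_none : opt_rel E None None
  | opt_rel_some a b : E a b -> opt_rel E (Some a) (Some b).

Definition machine_rel (A : Type) (lookup : A -> machine A)
    (E : machine A -> machine A -> Prop) (M N : machine A) : Prop :=
  [/\ List.Forall2 (opt_rel (addr_rel lookup E)) (regs M) (regs N),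
      prog M = prog N
    & List.Forall2 (addr_rel lookup E) (tape M) (tape N)].

Inductive equivA (A : Type) (num : machine A -> A) (lookup : A -> machine A) :
    machine A -> machine A -> Prop :=
  | equivA_refl M : equivA num lookup M M
  | equivA_sym M N : equivA num lookup M N -> equivA num lookup N M
  | equivA_trans M N K :
      equivA num lookup M N -> equivA num lookup N K -> equivA num lookup M K
  | equivA_head M Z N :
      head_steps num lookup M Z ->
      machine_rel lookup (equivA num lookup) Z N ->
      equivA num lookup M N.

Inductive c_step (A : Type) (num : machine A -> A) (lookup : A -> machine A) :
    machine A -> machine A -> Prop :=
  | c_head M N : head_step num lookup M N -> c_step num lookup M N
  | c_reg R i P T a M'
      (v : valid_for R P) (v' : valid_for (upd R i (num M')) P) :
      nth None R i = Some a -> c_step num lookup (lookup a) M' ->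
      c_step num lookup (Machine T v) (Machine T v')
  | c_tape R P T1 a T2 M' (v : valid_for R P) :
      c_step num lookup (lookup a) M' ->
      c_step num lookup (Machine (T1 ++ a :: T2) v)
                        (Machine (T1 ++ num M' :: T2) v).

Definition c_steps (A : Type) (num : machine A -> A) (lookup : A -> machine A) :
    machine A -> machine A -> Prop :=
  clos_refl_trans (machine A) (c_step num lookup).

(* Main.v *)
Require Import Defs.
From mathcomp Require Import all_boot.

(** The nontrivial direction is the confluence of [c_step], by the
Tait--Martin-Löf method: a parallel step contracts the registers and the tape
pointwise and then possibly performs one head step. Head steps are
deterministic and commute with pointwise parallel steps, so parallel steps have
the diamond property. Joinability is then an equivalence relation, and it is
closed under the rule generating [equivA] because pointwise joins of the
registers and of the tape assemble into a join of machines. *)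

Set Implicit Arguments.
Unset Strict Implicit.
Unset Printing Implicit Defensive.

(** * Confluence of the reflexive-transitive closure *)

Definition diamond (T : Type) (R : T -> T -> Prop) : Prop :=
  forall x y z, R x y -> R x z -> exists2 w, R y w & R z w.

Section Diamond.
Context (T : Type) (R : T -> T -> Prop).
Local Notation "R ^*" := (clos_refl_trans T R).

(** Each tile turns the single step on its near side into a single step on its far side, so tiles
    stack along the sequence from [x] to [z]. *)
Lemma diamond_strip x y z :
  diamond R -> R^* x z -> R x y -> exists2 w, R^* y w & R z w.
Proof.
move=> dR xz; elim: xz y => {x z} [x z xz y xy|x y xy|x u z _ IH1 _ IH2 y xy].
- by have [w yw zw] := dR _ _ _ xy xz; exists w; first exact: rt_step.
- by exists y; first exact: rt_refl.
- have [w yw /IH2[t wt zt]] := IH1 _ xy.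
  by exists t => //; apply: rt_trans yw wt.
Qed.

Lemma diamond_clos_refl_trans : diamond R -> diamond (R^*).
Proof.
move=> dR x y z xy; elim: xy z => {x y} [x y xy z xz|x z xz|x u y _ IH1 _ IH2 z xz].
- have [w yw zw] := diamond_strip dR xz xy.
  by exists w => //; apply: rt_step.
- by exists z => //; apply: rt_refl.
- have [w /IH2[t yt wt] zw] := IH1 _ xz.
  by exists t => //; apply: rt_trans zw wt.
Qed.

End Diamond.

Lemma clos_refl_trans_sub (T : Type) (R S : T -> T -> Prop) x y :
  (forall u v, R u v -> clos_refl_trans T S u v) ->
  clos_refl_trans T R x y -> clos_refl_trans T S x y.
Proof.
move=> RS; elim=> {x y} [x y /RS //|x|x y z _ xy _]; first exact: rt_refl.
exact: rt_trans.
Qed.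

(** * Relations lifted to lists and options *)

Section PointwiseRelations.
Context (A B C : Type).

Lemma Forall2_refl (E : A -> A -> Prop) s :
  (forall a, E a a) -> List.Forall2 E s s.
Proof. by move=> Exx; elim: s; constructor. Qed.

(* Transparent, as are [opt_rel_sub] and [machine_rel_sub], so that the guard condition accepts
   the nested inductions on [equivA] and [par] below. *)
Lemma Forall2_sub (E F : A -> B -> Prop) s t :
  (forall a b, E a b -> F a b) -> List.Forall2 E s t -> List.Forall2 F s t.
Proof. by move=> EF; elim=> *; constructor; auto. Defined.

Lemma opt_rel_refl (E : A -> A -> Prop) o : (forall a, E a a) -> opt_rel E o o.
Proof. by move=> Exx; case: o => [a|]; constructor. Qed.

Lemma opt_rel_sub (E F : A -> A -> Prop) o p :
  (forall a b, E a b -> F a b) -> opt_rel E o p -> opt_rel F o p.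
Proof. by move=> EF [|a b ab]; constructor; auto. Defined.

(** The common source is remembered existentially in each position: two reductions of one list
    become a single relation between their results, to which a pointwise join can be applied. *)
Lemma Forall2_span (E : A -> B -> Prop) (F : A -> C -> Prop) s t u :
  List.Forall2 E s t -> List.Forall2 F s u ->
  List.Forall2 (fun b c => exists2 a, E a b & F a c) t u.
Proof.
move=> st; elim: st u => {s t} [|a b s t ab _ IH] u su; inversion su; subst.
  by constructor.
by constructor; [exists a|apply: IH].
Qed.

Lemma Forall2_join (E : A -> C -> Prop) (F : B -> C -> Prop) s t :
  List.Forall2 (fun a b => exists2 c, E a c & F b c) s t ->
  exists2 u, List.Forall2 E s u & List.Forall2 F t u.
Proof.
elim=> {s t} [|a b s t [c ac bc] _ [u su tu]]; first by exists [::]; constructor.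
by exists (c :: u); constructor.
Qed.

End PointwiseRelations.

(** * Registers: updates, reading and validity *)

Section Registers.
Context (A : Type).
Implicit Types (E F : A -> A -> Prop) (R : registers A).

Lemma opt_rel_span E F o p q :
  opt_rel E o p -> opt_rel F o q ->
  opt_rel (fun b c => exists2 a, E a b & F a c) p q.
Proof.
by case=> [|a b ab] oq; inversion oq; subst; constructor; exists a.
Qed.

Lemma opt_rel_join E F o p :
  opt_rel (fun a b => exists2 c, E a c & F b c) o p ->
  exists2 q, opt_rel E o q & opt_rel F p q.
Proof.
case=> [|a b [c ac bc]]; first by exists None; constructor.
by exists (Some c); constructor.
Qed.

Lemma upd_cons0 o R (a : A) : upd (o :: R) 0 a = Some a :: R.
Proof. by []. Qed.

Lemma upd_consS o R i (a : A) : upd (o :: R) i.+1 a = o :: upd R i a.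
Proof. by rewrite /upd /= ltnS; case: ifP. Qed.

Lemma upd_cat R o R' (a : A) :
  upd (R ++ o :: R') (size R) a = R ++ Some a :: R'.
Proof. by elim: R => //= p R IH; rewrite upd_consS IH. Qed.

Lemma upd_nth R i (a : A) : nth None R i = Some a -> upd R i a = R.
Proof.
by elim: R i => [|o R IH] [|i] //= Ri; rewrite ?upd_cons0 ?upd_consS ?Ri ?IH.
Qed.

Lemma opt_rel_upd E R R' i a b :
  List.Forall2 (opt_rel E) R R' -> E a b ->
  List.Forall2 (opt_rel E) (upd R i a) (upd R' i b).
Proof.
move=> RR' ab; elim: RR' i => [|o p S S' op SS' IH] [|i]; do ?by constructor.
- by rewrite !upd_cons0; constructor=> //; constructor.
- by rewrite !upd_consS; constructor.
Qed.

Lemma opt_rel_nth E R R' i a :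
  List.Forall2 (opt_rel E) R R' -> nth None R i = Some a ->
  exists2 b, nth None R' i = Some b & E a b.
Proof.
move=> RR'; elim: RR' i => [|o p S S' op _ IH] [|i] //=; last exact: IH.
by case: op => // c d cd [<-]; exists d.
Qed.

Lemma opt_rel_isSome E R R' :
  List.Forall2 (opt_rel E) R R' -> map isSome R = map isSome R'.
Proof. by elim=> //= o p S S' [|a b _] _ ->. Qed.

Lemma initialized_isSome R R' n :
  map isSome R = map isSome R' -> initialized R n = initialized R' n.
Proof.
move=> RR'; apply/setP=> i; rewrite !inE.
(* Beyond the end of [S] the defaults [None] and [false] agree. *)
have nthE (S : registers A) : isSome (nth None S i) = nth false (map isSome S) i.
  case: (ltnP i (size S)) => iS; first by rewrite (nth_map None).
  by rewrite !nth_default ?size_map.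
by rewrite !nthE RR'.
Qed.

(** For a fixed program, validity depends only on the number of registers and on which of them are
    initialized; [opt_rel] preserves both. *)
Lemma opt_rel_valid E R R' P :
  List.Forall2 (opt_rel E) R R' -> valid_for R P -> valid_for R' P.
Proof.
move=> /opt_rel_isSome RR'; rewrite /valid_for.
have -> : size R' = size R by rewrite -(size_map isSome R') -RR' size_map.
by rewrite (initialized_isSome _ RR').
Qed.

Lemma machine_eq (M N : machine A) :
  regs M = regs N -> prog M = prog N -> tape M = tape N -> M = N.
Proof.
case: M N => [R P T v] [R' P' T' v'] /= eR eP eT.
by move: v'; rewrite -eR -eP -eT => v'; rewrite (bool_irrelevance v v').
Qed.

End Registers.

(** * Relations lifted to machines *)

Section Machines.
Context (A : Type) (num : machine A -> A) (lookup : A -> machine A).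
Implicit Types (M N K Z : machine A) (E F : machine A -> machine A -> Prop).

Lemma machine_rel_refl E M : (forall Z, E Z Z) -> machine_rel lookup E M M.
Proof.
move=> Exx; split=> //; apply: Forall2_refl => *; last exact: Exx.
by apply: opt_rel_refl => *; apply: Exx.
Qed.

Lemma machine_rel_sub E F M N :
  (forall Z K, E Z K -> F Z K) ->
  machine_rel lookup E M N -> machine_rel lookup F M N.
Proof.
move=> EF [rMN pMN tMN]; split=> //.
- by apply: Forall2_sub rMN => o p; apply: opt_rel_sub => a b; apply: EF.
- by apply: Forall2_sub tMN => a b; apply: EF.
Defined.

Lemma machine_rel_span E F M N K :
  machine_rel lookup E M N -> machine_rel lookup F M K ->
  machine_rel lookup (fun U V => exists2 Z, E Z U & F Z V) N K.
Proof.
move=> [rMN pMN tMN] [rMK pMK tMK]; split; last 2 first.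
- by rewrite -pMN.
- by apply: Forall2_sub (Forall2_span tMN tMK) => b c [a ab ac]; exists (lookup a).
apply: Forall2_sub (Forall2_span rMN rMK) => o p [q qo qp].
by apply: opt_rel_sub (opt_rel_span qo qp) => b c [a ab ac]; exists (lookup a).
Qed.

(* Surjectivity of [lookup] turns the joining machines into addresses. *)
Lemma machine_rel_join E F M N :
  cancel num lookup ->
  machine_rel lookup (fun U V => exists2 Z, E U Z & F V Z) M N ->
  exists2 K, machine_rel lookup E M K & machine_rel lookup F N K.
Proof.
move=> numK [rMN pMN tMN].
have addr_join a b : addr_rel lookup (fun U V => exists2 Z, E U Z & F V Z) a b ->
    exists2 c, addr_rel lookup E a c & addr_rel lookup F b c.
  by case=> Z aZ bZ; exists (num Z); rewrite /addr_rel numK.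
have [T MT NT] := Forall2_join (Forall2_sub addr_join tMN).
have [R MR NR] : exists2 R, List.Forall2 (opt_rel (addr_rel lookup E)) (regs M) R
    & List.Forall2 (opt_rel (addr_rel lookup F)) (regs N) R.
  apply: Forall2_join; apply: Forall2_sub rMN => o p op.
  by apply: opt_rel_join; apply: opt_rel_sub op.
by exists (Machine T (opt_rel_valid MR (machine_valid M))); split.
Qed.

Lemma machine_rel_append E M N T T' :
  machine_rel lookup E M N -> List.Forall2 (addr_rel lookup E) T T' ->
  machine_rel lookup E (append M T) (append N T').
Proof. by case=> rMN pMN tMN TT'; split=> //; apply: List.Forall2_app. Qed.

(** * Head reduction: inversion, determinism and tape extension *)

Local Notation head := (head_step num lookup).
Local Notation "M ->c N" := (c_step num lookup M N) (at level 70).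
Local Notation "M ->>c N" := (c_steps num lookup M N) (at level 70).

(* Equations between components, so that no validity proof is compared. *)
Definition head_spec M N : Prop :=
  match prog M with
  | LoadI i P => exists a,
      [/\ tape M = a :: tape N, regs N = upd (regs M) i a & prog N = P]
  | PEnd (AppI i j k Q) => exists a b,
      [/\ nth None (regs M) i = Some a, nth None (regs M) j = Some b,
          regs N = upd (regs M) k (addr_app num lookup a b), prog N = Q
        & tape N = tape M]
  | PEnd (AEnd (CallI i)) => exists2 a,
      nth None (regs M) i = Some a & N = append (lookup a) (tape M)
  | PEnd (AEnd EpsI) => False
  end.

Lemma head_stepP M N : head M N <-> head_spec M N.
Proof.
split; first by case=> *; rewrite /head_spec /=; do ?eexists; eauto.
case: M N => R P T v; case: P v => [i P|[i j k Q|[|i]]] v [R' P' T' v'] //=.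
- by case=> a /= [eT eR eP]; subst; apply: head_load.
- by case=> a [b /= [Ri Rj eR eP eT]]; subst; apply: head_app.
- by case=> a /= Ri ->; apply: head_call.
Qed.

Lemma head_step_det M N K : head M N -> head M K -> N = K.
Proof.
move=> /head_stepP + /head_stepP; rewrite /head_spec.
case: (prog M) => [i P|[i j k Q|[|i]]] //.
- by case=> a [-> rN pN] [_ [[<- eT] rK pK]]; apply: machine_eq; congruence.
- case=> a [b [-> -> rN pN tN]] [_ [_ [[<-] [<-] rK pK tK]]].
  by apply: machine_eq; congruence.
- by case=> a -> -> [_ [<-] ->].
Qed.

(** [Load] reads the front of the tape, whereas [T] is added at the back; for [Call] this is
    associativity of concatenation. *)
Lemma head_step_append M N T : head M N -> head (append M T) (append N T).
Proof.
move=> /head_stepP + ; rewrite head_stepP /head_spec /=.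
case: (prog M) => [i P|[i j k Q|[|i]]] //.
- by case=> a [-> rN pN]; exists a.
- by case=> a [b [Ri Rj rN pN ->]]; exists a, b.
- case=> a Ri ->; exists a => //.
  by apply: machine_eq => //=; rewrite catA.
Qed.

(** * Parallel reduction and its diamond property *)

(* [par_refl] does not follow from [par_cong]: machines may be cyclic, a register
   containing the address of the machine itself. *)
Inductive par : machine A -> machine A -> Prop :=
  | par_refl M : par M M
  | par_cong M N : machine_rel lookup par M N -> par M N
  | par_head M M' N : machine_rel lookup par M M' -> head M' N -> par M N.

Section ParInduction.
Context (Q : machine A -> machine A -> Prop).
Hypothesis Q_refl : forall M, Q M M.
Hypothesis Q_cong : forall M N, machine_rel lookup Q M N -> Q M N.
Hypothesis Q_head :
  forall M M' N, machine_rel lookup Q M M' -> head M' N -> Q M N.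

(** Unlike the generated principle, this one gives induction hypotheses for the steps nested inside
    [machine_rel]. *)
Fixpoint par_nested_ind M N (p : par M N) : Q M N :=
  match p with
  | par_refl M => Q_refl M
  | par_cong _ _ r => Q_cong (machine_rel_sub par_nested_ind r)
  | par_head _ _ _ r h => Q_head (machine_rel_sub par_nested_ind r) h
  end.

End ParInduction.

Section EquivInduction.
Context (Q : machine A -> machine A -> Prop).
Hypothesis Q_refl : forall M, Q M M.
Hypothesis Q_sym : forall M N, Q M N -> Q N M.
Hypothesis Q_trans : forall M N K, Q M N -> Q N K -> Q M K.
Hypothesis Q_head : forall M Z N,
  head_steps num lookup M Z -> machine_rel lookup Q Z N -> Q M N.

Fixpoint equivA_nested_ind M N (p : equivA num lookup M N) : Q M N :=
  match p with
  | equivA_refl M => Q_refl M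
  | equivA_sym _ _ p => Q_sym (equivA_nested_ind p)
  | equivA_trans _ _ _ p q =>
      Q_trans (equivA_nested_ind p) (equivA_nested_ind q)
  | equivA_head _ _ _ h r => Q_head h (machine_rel_sub equivA_nested_ind r)
  end.

End EquivInduction.

(** [par_refl] merges into the congruence case, because lifting a reflexive relation to machines
    keeps it reflexive. *)
Lemma par_inv M N : par M N ->
  machine_rel lookup par M N \/ exists2 M', machine_rel lookup par M M' & head M' N.
Proof.
case=> [{}M|{}M {}N r|{}M M' {}N r h]; [left|by left|by right; exists M'].
by apply: machine_rel_refl => Z; apply: par_refl.
Qed.

Lemma par_append M N T T' : par M N ->
  List.Forall2 (addr_rel lookup par) T T' -> par (append M T) (append N T').
Proof.
move=> /par_inv[r|[M' r h]] TT'; first exact/par_cong/machine_rel_append.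
exact: par_head (machine_rel_append r TT') (head_step_append _ h).
Qed.

(** Pointwise related machines have the same program, hence execute the same instruction. [Load] and
    [App] give componentwise related results; for [Call] the step of the called machine is extended
    by the tape, and it may itself end in a head step. *)
Lemma head_step_par M N M' : cancel num lookup ->
  head M N -> machine_rel lookup par M M' -> exists2 N', head M' N' & par N N'.
Proof.
move=> numK MN; case: MN M' => {M N}
  [R i P a T v v'|R i j k Q a b T v v' Ri Rj|R i a T v Ri] [R' P' T' w] [/= rR eP rT];
  subst P'.
- inversion rT as [|? a' ? T'' aa' TT'']; subst.
  exists (Machine T'' (valid_for_load a' w)); first exact: head_load.
  by apply: par_cong; split=> //; apply: opt_rel_upd.
- have [a' Ri' aa'] := opt_rel_nth rR Ri; have [b' Rj' bb'] := opt_rel_nth rR Rj.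
  exists (Machine T' (valid_for_app (addr_app num lookup a' b') w)).
    exact: head_app.
  apply: par_cong; split=> //; apply: opt_rel_upd => //.
  rewrite /addr_rel /addr_app !numK; apply: par_append => //.
  by constructor=> //; constructor.
- have [a' Ri' aa'] := opt_rel_nth rR Ri.
  by exists (append (lookup a') T'); [apply: head_call|apply: par_append].
Qed.

Lemma par_diamond : cancel num lookup -> diamond par.
Proof.
move=> numK M N K MN.
(* In each position the induction hypothesis for the step from [Z] to [U] joins it with any step
   from [Z] to [V]; the pointwise joins assemble into [W]. *)
have join Z U V : machine_rel lookup (fun X Y => forall W, par X W ->
      exists2 X', par Y X' & par W X') Z U -> machine_rel lookup par Z V ->
    exists2 W, machine_rel lookup par U W & machine_rel lookup par V W.
  move=> ZU ZV; apply: machine_rel_join => //.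
  by apply: machine_rel_sub (machine_rel_span ZU ZV) => X Y [Z' ZX]; apply: ZX.
elim/par_nested_ind: MN K => {M N} [M|M N r|M M' N r h] K MK.
- by exists K => //; apply: par_refl.
- case: (par_inv MK) => [/(join _ _ _ r)[U NU KU]|[Z /(join _ _ _ r)[U NU ZU] ZK]].
    by exists U; apply: par_cong.
  have [V UV KV] := head_step_par numK ZK ZU.
  by exists V => //; apply: par_head NU UV.
- case: (par_inv MK) => [/(join _ _ _ r)[U M'U KU]|[Z /(join _ _ _ r)[U M'U ZU] ZK]].
    have [V UV NV] := head_step_par numK h M'U.
    by exists V => //; apply: par_head KU UV.
  (* Both sides perform a head step; transported to [U], the two coincide by determinism. *)
  have [V UV NV] := head_step_par numK h M'U.
  have [W UW KW] := head_step_par numK ZK ZU.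
  by rewrite (head_step_det UW UV) in KW; exists V.
Qed.

(** * Parallel steps as sequences of [c_step] *)

Lemma valid_for_cat (R : registers A) a b R' P :
  valid_for (R ++ Some a :: R') P -> valid_for (R ++ Some b :: R') P.
Proof.
move=> v; rewrite -(upd_cat R (Some a)); apply: valid_for_upd v.
by rewrite nth_cat ltnn subnn.
Qed.

Lemma c_steps_reg (R R' : registers A) P T a b
    (v : valid_for (R ++ Some a :: R') P) (w : valid_for (R ++ Some b :: R') P) :
  cancel num lookup -> cancel lookup num ->
  lookup a ->>c lookup b -> Machine T v ->>c Machine T w.
Proof.
(* Addresses are written as [num] of machines, so that the induction on the reduction sequence runs
   over machines. *)
move=> numK lookupK; move: v w; rewrite -(lookupK a) -(lookupK b) !numK.
move=> v w ab; elim: ab v w => {a b} [M N MN|M|M N K _ IH1 _ IH2] v w.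
- apply: rt_step; move: w; rewrite -(upd_cat R (Some (num M)) R' (num N)) => w.
  by apply: (@c_reg _ _ _ _ _ _ _ (num M)); rewrite ?numK // nth_cat ltnn subnn.
- by rewrite (bool_irrelevance v w); apply: rt_refl.
- have u := valid_for_cat (num N) v.
  exact: rt_trans (IH1 v u) (IH2 u w).
Qed.

(** The prefix [R] collects the registers already reduced, and the induction is on the remaining
    ones. *)
Lemma c_steps_regs (R R1 R2 : registers A) P T
    (v : valid_for (R ++ R1) P) (w : valid_for (R ++ R2) P) :
  cancel num lookup -> cancel lookup num ->
  List.Forall2 (opt_rel (addr_rel lookup (c_steps num lookup))) R1 R2 ->
  Machine T v ->>c Machine T w.
Proof.
move=> numK lookupK r; elim: r R v w => {R1 R2} [|o p R1 R2 op _ IH] R v w.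
  by rewrite (bool_irrelevance v w); apply: rt_refl.
case: op v w => [|a b ab] v w.
  by move: v w; rewrite -!(cat_rcons None) => v w; apply: IH.
have u := valid_for_cat b v.
apply: rt_trans (c_steps_reg T v u numK lookupK ab) _.
by move: u w; rewrite -!(cat_rcons (Some b)) => u w; apply: IH.
Qed.

Lemma c_steps_tape (R : registers A) P (v : valid_for R P) T T1 T2 :
  cancel num lookup -> cancel lookup num ->
  List.Forall2 (addr_rel lookup (c_steps num lookup)) T1 T2 ->
  Machine (T ++ T1) v ->>c Machine (T ++ T2) v.
Proof.
move=> numK lookupK r; elim: r T => {T1 T2} [|a b T1 T2 ab _ IH] T.
  exact: rt_refl.
apply: (@rt_trans _ _ _ (Machine (T ++ b :: T1) v)); last first.
  by rewrite -!(cat_rcons b); apply: IH.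
rewrite /addr_rel in ab; rewrite -(lookupK a) -(lookupK b).
elim: ab => {a b IH} [M N MN|M|M N K _ MN _ NK]; last exact: rt_trans MN NK.
  by apply: rt_step; apply: c_tape; rewrite numK.
exact: rt_refl.
Qed.

Lemma machine_rel_c_steps M N :
  cancel num lookup -> cancel lookup num ->
  machine_rel lookup (c_steps num lookup) M N -> M ->>c N.
Proof.
case: M N => [R P T v] [R' P' T' w] numK lookupK [/= rR eP rT]; subst P'.
exact: rt_trans (@c_steps_regs [::] _ _ _ T v w numK lookupK rR)
  (@c_steps_tape _ _ w [::] _ _ numK lookupK rT).
Qed.

Lemma par_c_steps M N :
  cancel num lookup -> cancel lookup num -> par M N -> M ->>c N.
Proof.
move=> numK lookupK; elim/par_nested_ind=> {M N} [M|M N r|M M' N r h].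
- exact: rt_refl.
- exact: machine_rel_c_steps.
- apply: rt_trans (machine_rel_c_steps numK lookupK r) _.
  by apply: rt_step; apply: c_head.
Qed.

(** * Embedding [c_step] into [par] and [equivA] *)

(** With [E] reflexive, the one-component rules [c_reg] and [c_tape] are instances of closure under
    [machine_rel]. Applied to both [par] and [equivA]. *)
Lemma c_step_sub E : cancel num lookup ->
  (forall Z, E Z Z) -> (forall Z K, head Z K -> E Z K) ->
  (forall Z K, machine_rel lookup E Z K -> E Z K) ->
  forall M N, M ->c N -> E M N.
Proof.
move=> numK Exx headE relE M N; elim=> {M N}
  [M N|R i P T a M' v v' Ri _ E_a|R P T1 a T2 M' v _ E_a]; first exact: headE.
- have [rR _ rT] := machine_rel_refl (Machine T v) Exx; apply: relE; split=> //=.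
  (* The source registers become an update by their own content, so that both sides are updates at
     [i]. *)
  rewrite -{1}(upd_nth Ri); apply: opt_rel_upd => //.
  by rewrite /addr_rel numK.
- have [rR _ _] := machine_rel_refl (Machine T1 v) Exx; apply: relE; split=> //=.
  apply: List.Forall2_app; first by apply: Forall2_refl => b; apply: Exx.
  constructor; first by rewrite /addr_rel numK.
  by apply: Forall2_refl => b; apply: Exx.
Qed.

Lemma c_step_par M N : cancel num lookup -> M ->c N -> par M N.
Proof.
move=> numK; apply: c_step_sub => // [Z|Z K h|Z K r]; first exact: par_refl.
  by apply: par_head h; apply: machine_rel_refl par_refl.
exact: par_cong.
Qed.

Lemma c_step_equivA M N : cancel num lookup -> M ->c N -> equivA num lookup M N.
Proof.
move=> numK; apply: c_step_sub => // [Z|Z K h|Z K r]; first exact: equivA_refl.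
  by apply: (equivA_head (rt_step _ _ _ _ h)); apply: machine_rel_refl; apply: equivA_refl.
(* With zero head steps the generating rule is closure under [machine_rel]. *)
exact: (equivA_head (rt_refl _ _ Z)).
Qed.

Lemma c_steps_equivA M N : cancel num lookup -> M ->>c N -> equivA num lookup M N.
Proof.
move=> numK; elim=> {M N} [M N|M|M N K _ MN _]; first exact: c_step_equivA.
  exact: equivA_refl.
exact: equivA_trans MN.
Qed.

(** * Confluence and joinability of equivalent machines *)

(** [par] lies between [c_step] and [c_steps], so [par] and [c_step] have the same
    reflexive-transitive closure. *)
Lemma c_steps_diamond :
  cancel num lookup -> cancel lookup num -> diamond (c_steps num lookup).
Proof.
move=> numK lookupK.
have c_par Z K : Z ->>c K -> clos_refl_trans _ par Z K.
  by apply: clos_refl_trans_sub => U V /(c_step_par numK); apply: rt_step.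
have par_c Z K : clos_refl_trans _ par Z K -> Z ->>c K.
  by apply: clos_refl_trans_sub => U V; apply: par_c_steps.
move=> M N K /c_par MN /c_par MK.
have [Z NZ KZ] := diamond_clos_refl_trans (par_diamond numK) MN MK.
by exists Z; apply: par_c.
Qed.

Lemma equivA_joinable M N : cancel num lookup -> cancel lookup num ->
  equivA num lookup M N -> exists2 Z, M ->>c Z & N ->>c Z.
Proof.
move=> numK lookupK; elim/equivA_nested_ind=> {M N}
  [M|M N [Z MZ NZ]|M N K [Z MZ NZ] [U NU KU]|M Z N h r].
- by exists M; apply: rt_refl.
- by exists Z.
(* Transitivity is where confluence enters: it joins the two reducts of [N]. *)
- have [V ZV UV] := c_steps_diamond numK lookupK NZ NU.
  by exists V; [apply: rt_trans MZ ZV|apply: rt_trans KU UV].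
(* The induction hypotheses join the components of [Z] and [N]; these joins form one machine [K]. *)
- have [K ZK NK] := machine_rel_join numK r.
  exists K; last exact: machine_rel_c_steps.
  apply: (@rt_trans _ _ _ Z); last exact: machine_rel_c_steps.
  by apply: clos_refl_trans_sub h => U V UV; apply: rt_step; apply: c_head.
Qed.

End Machines.

Theorem theorem3p11 (A : countType) (num : machine A -> A)
    (lookup : A -> machine A)
    (numK : cancel num lookup) (lookupK : cancel lookup num)
    (M N : machine A) :
  equivA num lookup M N <->
  exists Z : machine A, c_steps num lookup M Z /\ c_steps num lookup N Z.
Proof.
split=> [/(equivA_joinable numK lookupK)[Z MZ NZ]|[Z [MZ NZ]]]; first by exists Z.
apply: equivA_trans (c_steps_equivA numK MZ) _.
exact/equivA_sym/c_steps_equivA.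
Qed.
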